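(* Let $X$ be a random example with latent representations $Z_y=Z_y(X)$ and $Z_a=Z_a(X)$. Let $f$ map latent representations to $\mathbb{R}^{|\mathcal{Y}|}$ and $g$ map latent representations to $\mathbb{R}^{|\mathcal{A}|}$, both $L$-Lipschitz with respect to the $p$-norm, and let $h_y=\sigma_\lambda(f(Z_y))$, $h_a=\sigma_\lambda(g(Z_a))$, where $\sigma_\lambda(v)=e^{\lambda v}/\|e^{\lambda v}\|_1$ is the softmax with temperature $\lambda\ge0$. Let $\hat{Y}$ and $\hat{A}$ be the predicted label and predicted sensitive attribute, i.e. the coordinates maximizing $f(Z_y)$ and $g(Z_a)$ respectively (one-hot encoded). Use $\|\cdot\|_p$ as ground metric for the 1-Wasserstein distance (on pairs, the $p$-norm of the concatenated vectors). For an example $x$ with predictions $\hat{y},\hat{a}$ define the (nonnegative) margins $\xi_y(x)=f(Z_y)_{\hat{y}}-\max_{y'\neq\hat{y}}f(Z_y)_{y'}$ and $\xi_a(x)=g(Z_a)_{\hat{a}}-\max_{a'\neq\hat{a}}g(Z_a)_{a'}$. Fix $\xi>0$ and let $\delta=1-\mathbb{P}(\xi_y(X)\ge\xi,\ \xi_a(X)\ge\xi)$. Let $N=\big((|\mathcal{Y}|-1)^p+(|\mathcal{A}|-1)^p\big)^{1/p}$, $\alpha=\sqrt[p]{2}\,N\,(1-\delta)$ and $\iota=L(|\mathcal{Y}|+|\mathcal{A}|)^{|\frac12-\frac1p|}$. Then, setting $\lambda=\frac{1}{\xi}\log\left(\frac{2\xi\alpha}{\iota I_W(Z_y,Z_a)}\right)$,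 we have $$I_W(\hat{Y},\hat{A})\le 2I_W(Z_y,Z_a)\frac{\iota}{\xi}\left[1+\log\left(\max\left(4,\frac{2\xi\alpha}{\iota I_W(Z_y,Z_a)}\right)-1\right)\right]+\sqrt[p]{2}\,N\,\delta.$$
   Context: $\mathcal{Y}$ is the finite set of labels and $\mathcal{A}$ the finite set of sensitive attribute values. For random variables $U,V$, the Wasserstein Dependency Measure is $I_W(U,V)=W_1(p(U,V),p(U)p(V))$, where $W_1$ is the 1-Wasserstein distance for the ground metric, $p(U,V)$ the joint law and $p(U)p(V)$ the product of the marginal laws. The paper writes $N$ as $\left\|\binom{|\mathcal{Y}|}{|\mathcal{A}|}-1\right\|_p$, i.e. the $p$-norm of the vector $(|\mathcal{Y}|-1,|\mathcal{A}|-1)$. *)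

(* Defs.v *)
From HB Require Import structures.
From mathcomp Require Import all_boot all_order all_algebra.
From mathcomp Require Import all_classical all_reals all_analysis.
Set Implicit Arguments.
Unset Strict Implicit.
Unset Printing Implicit Defensive.
Import Order.TTheory GRing.Theory Num.Theory.
Import numFieldNormedType.Exports.
Local Open Scope classical_set_scope.
Local Open Scope ring_scope.

Notation "''rVB[' R ]_ n" := (g_sigma_algebraType (@open 'rV[R]_n))
  (at level 8, n at level 2, format "''rVB[' R ]_ n").

Definition pnorm (R : realType) (p : R) (n : nat) (v : 'rV[R]_n) : R :=
  (\sum_(i < n) `|v ord0 i| `^ p) `^ p^-1.

Definition onehot (R : realType) (n : nat) (i : 'I_n) : 'rV[R]_n :=
  \row_(j < n) (j == i)%:R.

Definition pair_dist (R : realType) (p : R) (m k : nat)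
  (z z' : ('rVB[R]_m * 'rVB[R]_k)%type) : R :=
  pnorm p (row_mx ((z.1 : 'rV[R]_m) - z'.1) ((z.2 : 'rV[R]_k) - z'.2)).

Definition coupling d (S : measurableType d) (R : realType)
  (mu nu : set S -> \bar R) (pi : probability (S * S)%type R) : Prop :=
  forall A : set S, measurable A ->
    pi (A `*` setT) = mu A /\ pi (setT `*` A) = nu A.

Definition W1 d (S : measurableType d) (R : realType) (c : S -> S -> R)
  (mu nu : set S -> \bar R) : \bar R :=
  ereal_inf [set t | exists pi : probability (S * S)%type R,
                        coupling mu nu pi /\
                        t = (\int[pi]_z (c z.1 z.2)%:E)%E].

Definition IW d (Omega : measurableType d) (R : realType)
  (P : probability Omega R) (p : R) (m k : nat)
  (U : Omega -> 'rVB[R]_m) (V : Omega -> 'rVB[R]_k) : \bar R :=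
  W1 (@pair_dist R p m k)
     (pushforward P (fun w => (U w, V w)))
     (product_measure1 (pushforward P U) (pushforward P V)).

(* Margin f(z)_{yhat} - max_{y' <> yhat} f(z)_{y'} (extended real; finite
   as soon as n >= 2). *)
Definition margin (R : realType) (n : nat) (s : 'rV[R]_n) (i : 'I_n) : \bar R :=
  ((s ord0 i)%:E - \big[Order.max/-oo%E]_(j < n | j != i) (s ord0 j)%:E)%E.

(* Main.v *)
Require Import Defs.
From HB Require Import structures.
From mathcomp Require Import all_boot all_order all_algebra.
From mathcomp Require Import all_classical all_reals all_analysis.
From mathcomp Require Import measurable_realfun ring lra.
Import Order.TTheory GRing.Theory Num.Theory.
Import numFieldNormedType.Exports.
Local Open Scope classical_set_scope.
Local Open Scope ring_scope.
Set Implicit Arguments.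
Unset Strict Implicit.

(** Softmax plays no role here. Take an almost optimal coupling [pi] of the
    joint law of the latent pair with the product of its marginals. If both
    margins at [z] are at least [xi] and a label pair at [z'] differs from the
    one at [z], then the scores at [z] and [z'] are far apart; by Lipschitz
    continuity the distance between the one-hot pairs is at most
    [2 * L / xi] times the distance between [z] and [z']. The exceptional [z]
    have mass [delta] and cost at most [4 `^ p^-1 <= 2 `^ p^-1 * N] each. No
    assumption is needed on the margins at [z'], so only [delta] for the joint
    law enters. Hence [IW] of the predictions is at most
    [2 * L / xi * w + 4 `^ p^-1 * delta], which is below the claimed bound since
    [L <= iota] and the logarithm is nonnegative.

    Under ties the predicted labels are not functions of the latent vectors, so
    [pi] cannot simply be pushed forward. Instead the latent space is cut into
    the finitely many cells on which the pairwise comparisons of the scores are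
    constant, and labels are drawn conditionally on the cells. *)

(** * Margins and the [p]-norm *)

Lemma powRK (R : realType) (p x : R) : 0 < p -> 0 <= x -> (x `^ p^-1) `^ p = x.
Proof. by move=> p0 x0; rewrite -powRrM mulVf ?gt_eqF// powRr1. Qed.

Lemma powRVK (R : realType) (p x : R) : 0 < p -> 0 <= x -> (x `^ p) `^ p^-1 = x.
Proof. by move=> p0 x0; rewrite -powRrM mulfV ?gt_eqF// powRr1. Qed.

(** The [p]-th power of [pnorm]. It adds up over concatenation, so label and attribute blocks can be
    estimated separately. *)
Definition psum (R : realType) (p : R) (n : nat) (v : 'rV[R]_n) : R :=
  \sum_(i < n) `|v ord0 i| `^ p.

Lemma psum_ge0 (R : realType) (p : R) n (v : 'rV[R]_n) : 0 <= psum p v.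
Proof. by apply: sumr_ge0 => i _; exact: powR_ge0. Qed.

Lemma pnormK (R : realType) (p : R) n (v : 'rV[R]_n) :
  0 < p -> pnorm p v `^ p = psum p v.
Proof. by move=> p0; rewrite powRK// psum_ge0. Qed.

Lemma ler_pnorm (R : realType) (p c : R) n m (v : 'rV[R]_n) (u : 'rV[R]_m) :
  0 < p -> 0 <= c ->
  (pnorm p v <= c * pnorm p u) = (psum p v <= c `^ p * psum p u).
Proof.
move=> p0 c0.
have nn k (x : 'rV[R]_k) : 0 <= pnorm p x by exact: powR_ge0.
apply/idP/idP => h.
  rewrite -!pnormK// -powRM//.
  by apply: ge0_ler_powR; rewrite ?nnegrE ?mulr_ge0 ?(ltW p0).
rewrite -[leRHS](powRVK (p := p))// ?mulr_ge0// powRM// pnormK//.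
by apply: ge0_ler_powR; rewrite ?invr_ge0 ?nnegrE ?mulr_ge0 ?powR_ge0 ?psum_ge0 ?(ltW p0).
Qed.

Lemma psum_row_mx (R : realType) (p : R) n m (v : 'rV[R]_n) (u : 'rV[R]_m) :
  psum p (row_mx v u) = psum p v + psum p u.
Proof.
rewrite /psum big_split_ord/=; congr (_ + _); apply: eq_bigr => i _;
  by rewrite ?row_mxEl ?row_mxEr.
Qed.

(** Distinct one-hot vectors differ by one in absolute value, in exactly two coordinates. *)
Lemma psum_onehot (R : realType) (p : R) n (i k : 'I_n) : 0 < p ->
  psum p (onehot R i - onehot R k) = (i != k)%:R *+ 2.
Proof.
move=> p0; rewrite /psum.
have [->|ik] := eqVneq i k.
  rewrite mul0rn big1// => j _.
  by rewrite !mxE subrr normr0 powR0 ?gt_eqF.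
rewrite (bigD1 i)//= (bigD1 k) 1?eq_sym//= big1 => [|j /andP[ji jk]].
  rewrite !mxE !eqxx (eq_sym k) (negbTE ik).
  by rewrite subr0 sub0r normrN normr1 powR1 addr0.
by rewrite !mxE (negbTE ji) (negbTE jk) subrr normr0 powR0 ?gt_eqF.
Qed.

(** Convexity of the [p]-th power with both weights equal to one half. *)
Lemma powR_midpoint (R : realType) (p a b : R) : 1 <= p -> 0 <= a -> 0 <= b ->
  ((a + b) / 2) `^ p *+ 2 <= a `^ p + b `^ p.
Proof.
move=> p1 a0 b0.
have h : 0 <= (2^-1 : R) <= 1 by rewrite invr_ge0 ler0n invf_le1 ?ler1n.
have [h1 h2] := andP h.
have := @convex_powR R p p1 (Itv01 h1 h2) a b.
rewrite !inE/= !in_itv/= !andbT => /(_ a0 b0).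
rewrite convRE [X in X `^ _ <= _]convRE/=.
have -> : unstable.onem (2^-1 : R) = 2^-1 by rewrite /unstable.onem; lra.
rewrite -!mulrDr (mulrC 2^-1 (a + b)) => h3.
rewrite -mulr_natr; lra.
Qed.

(* A score vector [s] with margin [xi] at [i] differs from any [t] maximal at
   [k <> i] by a total of at least [xi] on the coordinates [i] and [k]. *)
Lemma psum_onehot_margin (R : realType) (p xi : R) n (s t : 'rV[R]_n)
    (i k : 'I_n) : 1 <= p -> 0 < xi ->
  (forall j, j != i -> s ord0 j + xi <= s ord0 i) ->
  (forall j, t ord0 j <= t ord0 k) ->
  psum p (onehot R i - onehot R k) <= (2 / xi) `^ p * psum p (s - t).
Proof.
move=> p1 xi0 si tk; have p0 : 0 < p by exact: lt_le_trans p1.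
rewrite psum_onehot//; have [_|ik] := eqVneq i k.
  by rewrite mul0rn mulr_ge0 ?powR_ge0 ?psum_ge0.
have x2 : 0 < 2 / xi by rewrite divr_gt0.
set d := s - t.
(* The margin of [s] at [i] over [k] is at least [xi], while [t] does not prefer [i] to [k];
   subtracting gives a gap shared by two coordinates. *)
have dik : xi <= `|d ord0 i| + `|d ord0 k|.
  have h1 := si k; rewrite eq_sym in h1; have {}h1 := h1 ik.
  have h2 := tk i; rewrite /d !mxE.
  have h3 := ler_norm (s ord0 i - t ord0 i).
  have h4 := ler_norm (- (s ord0 k - t ord0 k)); rewrite normrN in h4.
  lra.
have dsum : `|d ord0 i| `^ p + `|d ord0 k| `^ p <= psum p d.
  rewrite /psum (bigD1 i)//= (bigD1 k) 1?eq_sym//= addrA lerDl.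
  by apply: sumr_ge0 => j _; exact: powR_ge0.
(* The two powers multiply to one, leaving exactly the [2] of distinct one-hot vectors; the midpoint
   inequality then yields the power of [xi / 2]. *)
apply: (@le_trans _ _ ((2 / xi) `^ p * (xi / 2) `^ p *+ 2)).
  rewrite -powRM ?(ltW x2) ?divr_ge0 ?(ltW xi0)//.
  have -> : 2 / xi * (xi / 2) = 1 by field; rewrite gt_eqF.
  by rewrite powR1.
rewrite -mulrnAr ler_wpM2l ?powR_ge0//; apply: le_trans dsum.
apply: le_trans (powR_midpoint p1 (normr_ge0 _) (normr_ge0 _)).
rewrite lerMn2r/= ge0_ler_powR ?nnegrE ?divr_ge0 ?addr_ge0 ?(ltW p0) ?(ltW xi0)//.
by rewrite ler_pM2r.
Qed.

(** The margin estimate holds block by block for [psum], which is additive over [row_mx], so pairing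
    leaves the constant unchanged. *)
Lemma pair_dist_onehot_margin (R : realType) (p L xi : R) (nY nA dy da : nat)
    (f : 'rV[R]_dy -> 'rV[R]_nY) (g : 'rV[R]_da -> 'rV[R]_nA)
    (z z' : ('rVB[R]_dy * 'rVB[R]_da)%type) (i k : 'I_nY) (j l : 'I_nA) :
  1 <= p -> 0 < L -> 0 < xi ->
  (forall u v : 'rV[R]_dy, pnorm p (f u - f v) <= L * pnorm p (u - v)) ->
  (forall u v : 'rV[R]_da, pnorm p (g u - g v) <= L * pnorm p (u - v)) ->
  (forall q, q != i -> f z.1 ord0 q + xi <= f z.1 ord0 i) ->
  (forall q, q != j -> g z.2 ord0 q + xi <= g z.2 ord0 j) ->
  (forall q, f z'.1 ord0 q <= f z'.1 ord0 k) ->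
  (forall q, g z'.2 ord0 q <= g z'.2 ord0 l) ->
  pair_dist p (onehot R i : 'rVB[R]_nY, onehot R j : 'rVB[R]_nA)
            (onehot R k : 'rVB[R]_nY, onehot R l : 'rVB[R]_nA)
    <= 2 * L / xi * pair_dist p z z'.
Proof.
move=> p1 L0 xi0 fL gL fi gj fk gl.
have p0 : 0 < p by exact: lt_le_trans p1.
have c0 : 0 <= 2 / xi by rewrite divr_ge0// ltW.
have -> : 2 * L / xi = 2 / xi * L by ring.
rewrite /pair_dist ler_pnorm ?(mulr_ge0 c0 (ltW L0))//= !psum_row_mx mulrDr powRM ?(ltW L0)//.
apply: lerD.
  apply: le_trans (psum_onehot_margin p1 xi0 fi fk) _.
  by rewrite -mulrA ler_wpM2l ?powR_ge0// -ler_pnorm ?(ltW L0).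
apply: le_trans (psum_onehot_margin p1 xi0 gj gl) _.
by rewrite -mulrA ler_wpM2l ?powR_ge0// -ler_pnorm ?(ltW L0).
Qed.

(** Each of the two blocks contributes at most [2] to the sum of [p]-th powers. *)
Lemma pair_dist_onehot_le (R : realType) (p : R) (nY nA : nat)
    (i k : 'I_nY) (j l : 'I_nA) : 0 < p ->
  pair_dist p (onehot R i : 'rVB[R]_nY, onehot R j : 'rVB[R]_nA)
            (onehot R k : 'rVB[R]_nY, onehot R l : 'rVB[R]_nA) <= 4 `^ p^-1.
Proof.
move=> p0; rewrite /pair_dist /pnorm ge0_ler_powR ?invr_ge0 ?nnegrE ?psum_ge0 ?(ltW p0)//.
rewrite -[leLHS]/(psum p _) psum_row_mx !psum_onehot//.
by case: (i != k); case: (j != l); rewrite /=; lra.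
Qed.

Lemma le_margin (R : realType) n (s : 'rV[R]_n) (i : 'I_n) (xi : R) :
  (xi%:E <= margin s i)%E <-> (forall j, j != i -> s ord0 j + xi <= s ord0 i).
Proof.
rewrite /margin; set m := \big[_/_]_(j < n | _) _.
(* The infinite values need care: with no competitor, [m] is [-oo], the margin is [+oo], and both
   sides hold. *)
have -> : (xi%:E <= (s ord0 i)%:E - m)%E = (m <= (s ord0 i - xi)%:E)%E.
  case: m => [r| |]/=; last by rewrite leNye leey.
    by rewrite !lee_fin; apply/idP/idP; lra.
  by rewrite !leye_eq.
split=> [/bigmax_leP[_ h] j ji|h].
  by have := h j ji; rewrite lee_fin lerBrDr.
apply/bigmax_leP; split=> [|j ji]; first exact: leNye.
by rewrite lee_fin lerBrDr h.
Qed.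

(** * Finitely valued random variables *)

Section FiniteValued.
Context d (T : measurableType d) (R : realType).

(** Phrased through fibres, which avoids choosing a sigma-algebra on [F]. *)
Definition fin_measurable (F : finType) (q : T -> F) :=
  forall t, measurable [set x | q x = t].

Lemma fin_measurable_pred (F : finType) (q : T -> F) (B : pred F) :
  fin_measurable q -> measurable [set x | B (q x)].
Proof.
move=> mq; rewrite (_ : [set _ | _] = \bigcup_(t in [set` B]) [set x | q x = t]).
  by apply: fin_bigcup_measurable => // t _; exact: mq.
by apply/seteqP; split => [x Bx|x [t Bt /= ->//]]; exists (q x).
Qed.

Lemma fin_measurable_fun d' (S : measurableType d') (F : finType) (q : T -> F)
    (e : F -> S) : fin_measurable q -> measurable_fun setT (e \o q).
Proof.
move=> mq _ B _; rewrite setTI.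
have /= := fin_measurable_pred (fun t => `[< B (e t) >]) mq.
by congr (measurable _); apply/seteqP; split => x /asboolP.
Qed.

Lemma fin_measurable_pair (F G : finType) (q : T -> F) (r : T -> G) :
  fin_measurable q -> fin_measurable r -> fin_measurable (fun x => (q x, r x)).
Proof.
move=> mq mr [t s].
rewrite (_ : [set _ | _] = [set x | q x = t] `&` [set x | r x = s]).
  exact: measurableI.
by apply/seteqP; split => [x [<- <-]|x [/= -> ->]].
Qed.

Lemma integral_fin (mu : {measure set T -> \bar R}) (F : finType) (q : T -> F)
    (h : F -> \bar R) : fin_measurable q -> (forall t, 0 <= h t)%E ->
  (\int[mu]_x h (q x) = \sum_t h t * mu [set x | q x = t])%E.
Proof.
move=> mq h0.
transitivity (\int[mu]_x (\sum_(t : F) h t * (\1_[set x | q x = t] x)%:E))%E.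
  apply: eq_integral => x _; rewrite (bigD1 (q x))//= big1 => [|t tq].
    by rewrite indicE mem_set// mule1 adde0.
  by rewrite indicE memNset ?mule0//= => /esym/eqP; exact/negP.
have mi t : measurable_fun setT (fun x => (\1_[set x | q x = t] x)%:E : \bar R).
  by apply/measurable_EFinP; exact: measurable_indic.
rewrite ge0_integral_sum//.
- apply: eq_bigr => t _; rewrite ge0_integralZl//.
  by rewrite integral_indic ?setIT.
- by move=> t; exact: measurable_funeM.
- by move=> t x _; rewrite mule_ge0.
Qed.

Lemma measure_fin (mu : {measure set T -> \bar R}) (F : finType) (q : T -> F)
    (B : pred F) : fin_measurable q ->
  (mu [set x | B (q x)] = \sum_(t | B t) mu [set x | q x = t])%E.
Proof.
move=> mq; rewrite -[X in mu X]setIT -integral_indic//; last exact: fin_measurable_pred.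
rewrite (eq_integral (fun x => (B (q x))%:R%:E)).
  rewrite (@integral_fin _ _ q (fun t => (B t)%:R%:E))//.
  rewrite [RHS]big_mkcond; apply: eq_bigr => t _.
  by case: (B t); rewrite ?mul1e ?mul0e.
move=> x _; rewrite indicE; congr ((nat_of_bool _)%:R%:E).
by apply/idP/idP; [move/set_mem|move=> ?; exact/mem_set].
Qed.

Lemma prob_fin (P : probability T R) (F : finType) (q : T -> F) (B : pred F) :
  fin_measurable q ->
  fine (P [set x | B (q x)]) = \sum_(t | B t) fine (P [set x | q x = t]).
Proof.
move=> mq; rewrite measure_fin// sum_fine// => t _.
by rewrite fin_num_measure.
Qed.

End FiniteValued.

Lemma fin_measurable_comp d d' (T : measurableType d) (S : measurableType d')
    (F : finType) (q : S -> F) (U : T -> S) :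
  measurable_fun setT U -> fin_measurable q -> fin_measurable (q \o U).
Proof. by move=> mU mq t; have := mU measurableT _ (mq t); rewrite setTI. Qed.

(** A convex combination of Dirac masses; it serves as the coupling of the label laws. *)
Lemma discrete_probability d (S : measurableType d) (R : realType) (I : finType)
    (w : I -> R) (x : I -> S) : (forall i, 0 <= w i) -> \sum_i w i = 1 ->
  exists pi : probability S R,
    (forall A, pi A = \sum_i (w i)%:E * \d_(x i) A)%E /\
    (forall h : S -> \bar R, measurable_fun setT h -> (forall z, 0 <= h z)%E ->
      \int[pi]_z h z = \sum_i (w i)%:E * h (x i))%E.
Proof.
move=> w0 w1.
(* [msum] sums a sequence indexed by naturals, so [I] is enumerated and the sequence continued by
   the zero measure. *)
pose m (k : nat) : {measure set S -> \bar R} :=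
  if insub k is Some j then mscale (NngNum (w0 (enum_val (j : 'I_#|I|))))
                              \d_(x (enum_val j)) else mzero.
have reI (F : I -> \bar R) : (\sum_i F i = \sum_(j < #|I|) F (enum_val j))%E.
  by rewrite -big_enum_val; apply: eq_bigl.
have mE A : msum m #|I| A = (\sum_i (w i)%:E * \d_(x i) A)%E.
  rewrite /msum reI.
  by apply: eq_bigr => j _; rewrite /m valK.
have m1 : msum m #|I| setT = 1%E.
  rewrite mE; under eq_bigr do rewrite diracT mule1.
  by rewrite sumEFin w1.
(* The total mass is one, so normalizing changes no value and only supplies the structure of a
   probability; the default [\d_point] is never reached. *)
pose pi : probability S R := mnormalize (msum m #|I|) \d_point.
have piE A : pi A = msum m #|I| A.
  by rewrite /pi /= /mnormalize/= m1 onee_eq0/= invr1 mule1.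
exists pi; split=> [A|h mh h0]; first by rewrite piE mE.
rewrite (eq_measure_integral (msum m #|I|)) => [|A _ _]; last exact: piE.
rewrite ge0_integral_measure_sum// reI.
apply: eq_bigr => j _; rewrite /m valK ge0_integral_mscale//.
by rewrite integral_dirac// diracT mul1e.
Qed.

(* Conditioning on the cells [t] and [t']: the labels are drawn independently
   from [a t _] and [b t' _], normalized by the marginals of [m]. Null cells
   cause no trouble: there [m] vanishes and the quotients [0 / 0] are [0]. *)
Lemma finite_gluing (R : realFieldType) (I T T' K : finType)
    (m : T -> T' -> R) (a : T -> I -> R) (b : T' -> K -> R) :
  (forall t t', 0 <= m t t') -> (forall t i, 0 <= a t i) ->
  (forall t' k, 0 <= b t' k) ->
  (forall t, \sum_i a t i = \sum_t' m t t') ->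
  (forall t', \sum_k b t' k = \sum_t m t t') ->
  exists g : I -> T -> T' -> K -> R,
    [/\ (forall i t t' k, 0 <= g i t t' k),
        (forall i t, \sum_t' \sum_k g i t t' k = a t i),
        (forall t' k, \sum_i \sum_t g i t t' k = b t' k),
        (forall t t', \sum_i \sum_k g i t t' k = m t t') &
        (forall i t t' k, g i t t' k != 0 -> a t i != 0 /\ b t' k != 0)].
Proof.
move=> m0 a0 b0 am bm.
pose M t := \sum_i a t i; pose M' t' := \sum_k b t' k.
have Mz t t' : M t = 0 -> m t t' = 0.
  by rewrite /M am => /psumr_eq0P; apply.
have M'z t t' : M' t' = 0 -> m t t' = 0.
  by rewrite /M' bm => /psumr_eq0P; apply.
have Mm t t' : M t / M t * m t t' = m t t'.
  by have [/Mz ->|?] := eqVneq (M t) 0; rewrite ?mulr0// divff// mul1r.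
have M'm t t' : m t t' * (M' t' / M' t') = m t t'.
  by have [/M'z ->|?] := eqVneq (M' t') 0; rewrite ?mul0r// divff// mulr1.
have az t i : M t = 0 -> a t i = 0.
  by move/psumr_eq0P; apply.
have bz t' k : M' t' = 0 -> b t' k = 0.
  by move/psumr_eq0P; apply.
have gk i t t' : \sum_k a t i / M t * m t t' * (b t' k / M' t') = a t i / M t * m t t'.
  by rewrite -mulr_sumr -mulr_suml -mulrA M'm.
have gi t t' k : \sum_i a t i / M t * m t t' * (b t' k / M' t') = m t t' * (b t' k / M' t').
  by rewrite -mulr_suml -mulr_suml -mulr_suml Mm.
exists (fun i t t' k => a t i / M t * m t t' * (b t' k / M' t')); split.
- by move=> *; rewrite !mulr_ge0 ?invr_ge0 ?sumr_ge0.
- move=> i t; under eq_bigr do rewrite gk.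
  rewrite -mulr_sumr -am -/(M t).
  by have [/[dup]/az -> ->|?] := eqVneq (M t) 0; rewrite ?mulr0// divfK.
- move=> t' k; rewrite exchange_big/=; under eq_bigr do rewrite gi.
  rewrite -mulr_suml -bm -/(M' t').
  have [/[dup]/bz -> ->|?] := eqVneq (M' t') 0; first by rewrite mul0r.
  by rewrite mulrC divfK.
- by move=> t t'; under eq_bigr do rewrite gk; rewrite -mulr_suml -mulr_suml Mm.
- move=> i t t' k; rewrite !mulf_eq0 !negb_or.
  by move=> /andP[/andP[/andP[-> _] _] /andP[-> _]].
Qed.

(** * Marginals and image laws of finitely valued maps *)

Lemma prob_marginal d (T : measurableType d) (R : realType)
    (P : probability T R) (F G : finType) (q : T -> F) (r : T -> G) (t : F) :
  fin_measurable q -> fin_measurable r ->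
  \sum_s fine (P [set x | (q x, r x) = (t, s)]) = fine (P [set x | q x = t]).
Proof.
move=> mq mr.
transitivity (fine (P [set x | [pred u : F * G | u.1 == t] (q x, r x)])).
  rewrite prob_fin; last exact: fin_measurable_pair.
  rewrite (reindex_onto (fun s => (t, s)) snd)/= => [|[? ?]/= /eqP -> //].
  by apply: eq_bigl => s; rewrite !eqxx.
by congr (fine (P _)); apply/seteqP; split => x /= /eqP.
Qed.

Lemma prob_marginalr d (T : measurableType d) (R : realType)
    (P : probability T R) (F G : finType) (q : T -> F) (r : T -> G) (s : G) :
  fin_measurable q -> fin_measurable r ->
  \sum_t fine (P [set x | (q x, r x) = (t, s)]) = fine (P [set x | r x = s]).
Proof.
move=> mq mr; rewrite -(prob_marginal _ _ mr mq); apply: eq_bigr => t _.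
by congr (fine (P _)); apply/seteqP; split => x /= [-> ->].
Qed.

Lemma pushforward_fin d d1 (Omega : measurableType d) (S1 : measurableType d1)
    (R : realType) (P : probability Omega R)
    (F : finType) (q : Omega -> F) (e : F -> S1) (A : set S1) :
  fin_measurable q ->
  (pushforward P (e \o q) A
    = \sum_t (fine (P [set o | q o = t]) * (e t \in A)%:R)%:E)%E.
Proof.
move=> mq; transitivity (P [set o | e (q o) \in A]).
  by congr (P _); apply/seteqP; split => x /=; [move/mem_set|move/set_mem].
rewrite (measure_fin P (fun t => e t \in A) mq) big_mkcond; apply: eq_bigr => t _.
rewrite EFinM fineK ?fin_num_measure//.
by case: (e t \in A); rewrite ?mule1 ?mule0.
Qed.

Section PushforwardProduct.
Local Open Scope ereal_scope.
Context d d1 d2 (Omega : measurableType d) (S1 : measurableType d1)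
  (S2 : measurableType d2) (R : realType) (P : probability Omega R).

(** The section of the rectangle at [u] is [B2] or empty, so the defining integral is that of a
    constant times an indicator. *)
Lemma product_pushforward_rectangle (U : Omega -> S1) (V : Omega -> S2) B1 B2 :
  measurable_fun setT U -> measurable B1 -> measurable B2 ->
  product_measure1 (pushforward P U) (pushforward P V) (B1 `*` B2)
    = P (U @^-1` B1) * P (V @^-1` B2).
Proof.
move=> mU mB1 mB2; rewrite /product_measure1.
rewrite (eq_integral (fun u => P (V @^-1` B2) * (\1_B1 u)%:E)); last first.
  move=> u _ /=; rewrite indicE; have [uB1|uB1] := boolP (u \in B1).
    by rewrite in_xsectionX// mule1.
  by rewrite notin_xsectionX// mule0 /pushforward preimage_set0 measure0.
have mi : measurable_fun setT (fun u => (\1_B1 u)%:E : \bar R).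
  by apply/measurable_EFinP; exact: measurable_indic.
rewrite ge0_integral_pushforward// => [||u _]; last first.
- by rewrite mule_ge0.
- exact: measurable_funeM.
have mUB : measurable (U @^-1` B1).
  by rewrite -[X in measurable X]setTI; exact: mU.
rewrite preimage_setT
  (eq_integral (fun o => P (V @^-1` B2) * (\1_(U @^-1` B1) o)%:E))//.
rewrite ge0_integralZl//; last by apply/measurable_EFinP; exact: measurable_indic.
by rewrite integral_indic// setIT muleC.
Qed.

Lemma product_pushforward_fin (F G : finType) (q : Omega -> F) (r : Omega -> G)
    (e1 : F -> S1) (e2 : G -> S2) (A : set (S1 * S2)) :
  fin_measurable q -> fin_measurable r -> measurable A ->
  product_measure1 (pushforward P (e1 \o q)) (pushforward P (e2 \o r)) A
    = \sum_(k : F * G) (fine (P [set o | q o = k.1]) * fine (P [set o | r o = k.2])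
         * ((e1 k.1, e2 k.2) \in A)%:R)%:E.
Proof.
move=> mq mr mA; rewrite /product_measure1.
pose p2 l := fine (P [set o | r o = l]).
have p2_ge0 l : (0 <= p2 l)%R by exact: fine_ge0.
(* The mass that the second law gives to the section of [A] at [u], written with the sections in the
   other direction so that measurability in [u] is visible. *)
pose h u : \bar R := \sum_l (p2 l)%:E * (\1_(ysection A (e2 l)) u)%:E.
have mU := fin_measurable_fun e1 mq.
have h_ge0 u : 0 <= h u by apply: sume_ge0 => l _; rewrite mule_ge0 ?lee_fin.
transitivity (\int[pushforward P (e1 \o q)]_u h u).
  apply: eq_integral => [//|u _]; rewrite [LHS](pushforward_fin P e2 _ mr); apply: eq_bigr => l _.
  by rewrite mem_xsection indicE mem_ysection EFinM.
have mh : measurable_fun setT h.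
  apply: emeasurable_sum => l; apply: measurable_funeM; apply/measurable_EFinP.
  by apply: measurable_indic; exact: measurable_ysection.
transitivity (\int[P]_o (h \o e1) (q o)).
  by apply: etrans (ge0_integral_pushforward (fin_measurable_fun e1 mq) _ measurableT mh _) _.
rewrite (@integral_fin _ _ _ P _ q (h \o e1) mq (fun t => h_ge0 (e1 t))).
rewrite -(pair_bigA _ (fun k l => (fine (P [set o | q o = k]) * p2 l
  * ((e1 k, e2 l) \in A)%:R)%:E))/=; apply: eq_bigr => k _.
rewrite muleC /h ge0_sume_distrr => [|l _]; last by rewrite mule_ge0 ?lee_fin.
apply: eq_bigr => l _.
rewrite indicE mem_ysection -mulrA !EFinM; congr (_ * _).
by rewrite fineK ?fin_num_measure.
Qed.

End PushforwardProduct.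

(** * Lifting a coupling to the labels *)

Section Lift.
Context dO d1 d2 d1' d2' (Omega : measurableType dO)
  (S1 : measurableType d1) (S2 : measurableType d2)
  (S1' : measurableType d1') (S2' : measurableType d2')
  (R : realType) (P : probability Omega R)
  (U : Omega -> S1) (V : Omega -> S2)
  (T1 T2 I1 I2 : finType) (c1 : S1 -> T1) (c2 : S2 -> T2)
  (y : Omega -> I1) (a : Omega -> I2) (e1 : I1 -> S1') (e2 : I2 -> S2').
Variables (c : S1 * S2 -> S1 * S2 -> R) (c' : S1' * S2' -> S1' * S2' -> R)
  (K D : R) (good : pred (T1 * T2)).
Hypotheses (mU : measurable_fun setT U) (mV : measurable_fun setT V).
Hypotheses (mc1 : fin_measurable c1) (mc2 : fin_measurable c2).
Hypotheses (my : fin_measurable y) (ma : fin_measurable a).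
Hypothesis mc :
  measurable_fun setT (fun z : (S1 * S2) * (S1 * S2) => c z.1 z.2).
Hypothesis mc' :
  measurable_fun setT (fun z : (S1' * S2') * (S1' * S2') => c' z.1 z.2).
Hypotheses (c_ge0 : forall z z', 0 <= c z z') (c'_ge0 : forall z z', 0 <= c' z z').
Hypotheses (K_ge0 : 0 <= K) (D_ge0 : 0 <= D).

Let cell (z : S1 * S2) := (c1 z.1, c2 z.2).
Let lab o := (y o, a o).
Let e (i : I1 * I2) := (e1 i.1, e2 i.2).

(** At [z] both labels come from one outcome [o], as under the joint law. At [z'] they come from two
    outcomes [o1] and [o2], as the product law samples the two blocks independently. *)
Hypothesis c'_le : forall o o1 o2 z z', cell z = cell (U o, V o) ->
  c1 z'.1 = c1 (U o1) -> c2 z'.2 = c2 (V o2) ->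
  c' (e (y o, a o)) (e (y o1, a o2)) <= K * c z z' + D * (~~ good (cell z))%:R.

Let mcell : fin_measurable cell.
Proof.
apply: fin_measurable_pair.
  exact: (fin_measurable_comp (@measurable_fst _ _ S1 S2) mc1).
exact: (fin_measurable_comp (@measurable_snd _ _ S1 S2) mc2).
Qed.

Let mc1U : fin_measurable (c1 \o U). Proof. exact: fin_measurable_comp. Qed.
Let mc2V : fin_measurable (c2 \o V). Proof. exact: fin_measurable_comp. Qed.

Let mcellUV : fin_measurable (fun o => cell (U o, V o)).
Proof. exact: fin_measurable_pair. Qed.

Let mlab : fin_measurable lab. Proof. exact: fin_measurable_pair. Qed.

(** [A] and [B] are the masses of a cell together with a label pair, under the joint law and under
    the product law; they are the data to be glued along [pi]. *)
Let A (t : T1 * T2) (i : I1 * I2) :=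
  fine (P [set o | (cell (U o, V o), lab o) = (t, i)]).

Let B (t : T1 * T2) (k : I1 * I2) :=
  fine (P [set o | (c1 (U o), y o) = (t.1, k.1)]) *
  fine (P [set o | (c2 (V o), a o) = (t.2, k.2)]).

(** Positive mass produces an actual outcome to which [c'_le] can be applied. *)
Let A_neq0 t i : A t i != 0 -> exists2 o, cell (U o, V o) = t & lab o = i.
Proof.
move=> At; apply: contrapT => h; move/negP: At; apply; apply/eqP.
rewrite /A (_ : [set _ | _] = set0) ?measure0//.
by apply/seteqP; split => // o [ot oi]; apply: h; exists o.
Qed.

Let B_neq0 t k : B t k != 0 -> exists o1 o2,
  [/\ c1 (U o1) = t.1, y o1 = k.1, c2 (V o2) = t.2 & a o2 = k.2].
Proof.
move=> Bt; apply: contrapT => h; move/negP: Bt; apply; apply/eqP.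
have [E|/set0P [x1 [? ?]]] := eqVneq [set o | (c1 (U o), y o) = (t.1, k.1)] set0.
  by rewrite /B E measure0 mul0r.
have [E|/set0P [x2 [? ?]]] := eqVneq [set o | (c2 (V o), a o) = (t.2, k.2)] set0.
  by rewrite /B E measure0 mulr0.
by exfalso; apply: h; exists x1, x2.
Qed.

Let Bsumr t : \sum_k B t k =
  fine (P [set o | c1 (U o) = t.1]) * fine (P [set o | c2 (V o) = t.2]).
Proof.
rewrite -(prob_marginal P t.1 mc1U my) -(prob_marginal P t.2 mc2V ma).
by rewrite big_distrlr/= pair_bigA.
Qed.

Let Bsuml k : \sum_t B t k =
  fine (P [set o | y o = k.1]) * fine (P [set o | a o = k.2]).
Proof.
rewrite -(prob_marginalr P k.1 mc1U my) -(prob_marginalr P k.2 mc2V ma).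
by rewrite big_distrlr/= pair_bigA.
Qed.

(** Drawing labels conditionally on the two cells turns [pi] into a coupling of the label laws. Its
    cost is the [pi]-integral of a function of the cells, bounded pointwise by [c'_le]. *)
Lemma W1_lift (pi : probability ((S1 * S2) * (S1 * S2))%type R) :
  coupling (pushforward P (fun o => (U o, V o)))
    (product_measure1 (pushforward P U) (pushforward P V)) pi ->
  (W1 c' (pushforward P (fun o => (e1 (y o), e2 (a o))))
     (product_measure1 (pushforward P (e1 \o y)) (pushforward P (e2 \o a)))
   <= K%:E * \int[pi]_z (c z.1 z.2)%:E
      + (D * fine (P [set o | ~~ good (c1 (U o), c2 (V o))]))%:E)%E.
Proof.
move=> pi_cpl.
have mcell1 : fin_measurable (fun z : (S1 * S2) * (S1 * S2) => cell z.1).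
  exact: (fin_measurable_comp measurable_fst mcell).
have mcell2 : fin_measurable (fun z : (S1 * S2) * (S1 * S2) => cell z.2).
  exact: (fin_measurable_comp measurable_snd mcell).
pose q (z : (S1 * S2) * (S1 * S2)) := (cell z.1, cell z.2).
have mq : fin_measurable q by exact: fin_measurable_pair.
pose m t t' := fine (pi [set z | q z = (t, t')]).
have Am t : \sum_i A t i = \sum_t' m t t'.
  rewrite (prob_marginal _ _ mcellUV mlab) (prob_marginal _ _ mcell1 mcell2).
  have [E _] := pi_cpl _ (mcell t).
  apply: etrans (congr1 fine (esym E)) _; congr (fine (pi _)).
  by apply/seteqP; split => z //= [].
(* Cells are rectangles, so the second marginal of [pi] gives them product mass. *)
have Bm t' : \sum_k B t' k = \sum_t m t t'.
  rewrite Bsumr (prob_marginalr _ _ mcell1 mcell2).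
  have [_] := pi_cpl _ (mcell t').
  have -> : [set z | cell z = t'] = [set u | c1 u = t'.1] `*` [set v | c2 v = t'.2].
    by apply/seteqP; split => [z /= <-//|[u v] /= []]; rewrite /cell/= => -> ->; case: t'.
  rewrite product_pushforward_rectangle// => piE.
  rewrite -fineM ?fin_num_measure//; congr fine; rewrite -piE; congr (pi _).
  apply/seteqP; split => z /=; last by move=> <-.
  by move=> [_ [E1 E2]]; rewrite /cell E1 E2 -surjective_pairing.
have [g [g0 gA gB gm gAB]] : exists g : I1 * I2 -> T1 * T2 -> T1 * T2 -> I1 * I2 -> R,
    [/\ (forall i t t' k, 0 <= g i t t' k),
        (forall i t, \sum_t' \sum_k g i t t' k = A t i),
        (forall t' k, \sum_i \sum_t g i t t' k = B t' k),
        (forall t t', \sum_i \sum_k g i t t' k = m t t') &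
        (forall i t t' k, g i t t' k != 0 -> A t i != 0 /\ B t' k != 0)].
  apply: finite_gluing => // *; rewrite ?mulr_ge0//; exact: fine_ge0.
(* The mass of a pair of label pairs: the glued mass with both cells summed out. *)
pose w (s : (I1 * I2) * (I1 * I2)) := \sum_t \sum_t' g s.1 t t' s.2.
have w_ge0 s : 0 <= w s by rewrite /w !sumr_ge0// => *; exact: sumr_ge0.
have wl i : \sum_k w (i, k) = fine (P [set o | lab o = i]).
  rewrite -(prob_marginalr _ _ mcellUV mlab) exchange_big/=.
  by apply: eq_bigr => t _; rewrite exchange_big/= gA.
have wr k : \sum_i w (i, k) = fine (P [set o | y o = k.1]) * fine (P [set o | a o = k.2]).
  rewrite -Bsuml; under eq_bigr do rewrite /w exchange_big/=.
  by rewrite exchange_big/=; apply: eq_bigr => t' _; rewrite gB.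
have w1 : \sum_s w s = 1.
  rewrite -(pair_bigA _ (fun i k => w (i, k)))/=; under eq_bigr do rewrite wl.
  rewrite -(prob_fin P predT mlab) (_ : [set _ | _] = setT) ?probability_setT//.
  by apply/seteqP; split.
have [rho [rhoE rho_int]] :=
  discrete_probability (fun s : (I1 * I2) * (I1 * I2) => (e s.1, e s.2)) w_ge0 w1.
pose cost := \sum_s w s * c' (e s.1) (e s.2).
(* The discrete law [rho] has the prescribed marginals, by [wl] and [wr], so its cost bounds the
   infimum. *)
apply: (@le_trans _ _ cost%:E).
  apply: ereal_inf_lbound; exists rho; split; last first.
    rewrite rho_int => [||z]; last by rewrite lee_fin.
      by rewrite /cost -sumEFin; apply: eq_bigr.
    exact/measurable_EFinP.
  move=> X mX; rewrite !rhoE; split.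
    rewrite (pushforward_fin P e X mlab) -(pair_bigA _ (fun i k => (w (i, k))%:E
      * \d_((e i, e k)) (X `*` setT))%E)/=.
    apply: eq_bigr => i _; rewrite -wl mulr_suml -sumEFin; apply: eq_bigr => k _.
    rewrite diracE EFinM; congr (_ * (nat_of_bool _)%:R%:E)%E.
    by rewrite in_setX in_setT andbT.
  rewrite product_pushforward_fin// -(pair_bigA _ (fun i k => (w (i, k))%:E
      * \d_((e i, e k)) (setT `*` X))%E)/= exchange_big/=.
  apply: eq_bigr => k _; rewrite -wr mulr_suml -sumEFin; apply: eq_bigr => i _.
  rewrite diracE EFinM; congr (_ * (nat_of_bool _)%:R%:E)%E.
  by rewrite in_setX in_setT.
(* The share of the cost carried by the pair of cells [t] and [t']. *)
pose H t t' := \sum_s g s.1 t t' s.2 * c' (e s.1) (e s.2).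
have costE : cost = \sum_t \sum_t' H t t'.
  under [RHS]eq_bigr do rewrite exchange_big/=.
  rewrite exchange_big/=; apply: eq_bigr => s _; rewrite mulr_suml.
  by apply: eq_bigr => t _; rewrite mulr_suml.
have gm' t t' : \sum_s g s.1 t t' s.2 = m t t'.
  by rewrite -gm (pair_bigA _ (fun i k => g i t t' k)).
(* On a cell of positive mass, [H / m] is an average of values of [c'] each of
   which is controlled by [c'_le]; on a null cell it is [0]. *)
have H_le (z : (S1 * S2) * (S1 * S2)) :
    H (cell z.1) (cell z.2) / m (cell z.1) (cell z.2)
      <= K * c z.1 z.2 + D * (~~ good (cell z.1))%:R.
  have r_ge0 : 0 <= K * c z.1 z.2 + D * (~~ good (cell z.1))%:R.
    by rewrite addr_ge0// mulr_ge0.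
  have [->|m_neq0] := eqVneq (m (cell z.1) (cell z.2)) 0; first by rewrite invr0 mulr0.
  have m_gt0 : 0 < m (cell z.1) (cell z.2) by rewrite lt0r m_neq0 fine_ge0.
  rewrite ler_pdivrMr// mulrC -gm' mulr_suml; apply: ler_sum => -[i [k1 k2]] _ /=.
  have [->|/gAB[/A_neq0[x0 Ex <-] /B_neq0[p1 [p2 [E1 /= <- E2 <-]]]]] :=
    eqVneq (g i (cell z.1) (cell z.2) (k1, k2)) 0; first by rewrite !mul0r.
  by rewrite ler_wpM2l// c'_le.
have m0H t t' : m t t' = 0 -> H t t' = 0.
  rewrite -gm' => /psumr_eq0P g_eq0; apply: big1 => s _.
  by rewrite g_eq0 ?mul0r.
pose eta (u : (T1 * T2) * (T1 * T2)) := (H u.1 u.2 / m u.1 u.2)%:E.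
have eta_ge0 u : (0 <= eta u)%E.
  by rewrite lee_fin divr_ge0 ?fine_ge0 ?sumr_ge0// => *; rewrite mulr_ge0.
(* Integrating [H / m] over a pair of cells multiplies it by [m] and returns [H]; on null pairs both
   vanish by [m0H]. *)
have -> : cost%:E = (\int[pi]_z eta (q z))%E.
  rewrite integral_fin// costE pair_bigA/= -sumEFin; apply: eq_bigr => -[t t'] _.
  rewrite -[X in (_ * X)%E]fineK ?fin_num_measure// -EFinM; congr EFin.
  rewrite -/(m t t') /=; have [/[dup]/m0H -> ->|?] := eqVneq (m t t') 0.
    by rewrite mulr0.
  by rewrite divfK.
pose bad := [set z : (S1 * S2) * (S1 * S2) | ~~ good (cell z.1)].
have mbad : measurable bad by exact: (fin_measurable_pred (predC good) mcell1).
apply: (@le_trans _ _ (\int[pi]_z (K%:E * (c z.1 z.2)%:E + D%:E * (\1_bad z)%:E))%E).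
  apply: ge0_le_integral => //.
  - exact: (fin_measurable_fun eta mq).
  - apply: emeasurable_funD; apply: measurable_funeM; apply/measurable_EFinP => //.
  - move=> z _; rewrite -!EFinM -EFinD lee_fin indicE.
    rewrite (_ : (z \in bad) = ~~ good (cell z.1)); first exact: H_le.
    by apply/idP/idP => [/set_mem//|?]; exact/mem_set.
rewrite ge0_integralD//; last 4 first.
- by move=> z _; rewrite mule_ge0 ?lee_fin.
- by apply: measurable_funeM; exact/measurable_EFinP.
- by move=> z _; rewrite mule_ge0 ?lee_fin.
- by apply: measurable_funeM; apply/measurable_EFinP; exact: measurable_indic.
rewrite ge0_integralZl//; [|exact/measurable_EFinP|by move=> z _; rewrite lee_fin].
rewrite ge0_integralZl//; last by apply/measurable_EFinP; exact: measurable_indic.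
rewrite integral_indic// setIT leeD2l// EFinM.
(* [bad] constrains the first component only, so its mass is read off the first marginal, the joint
   law of [U] and [V]. *)
have [E _] := pi_cpl _ (fin_measurable_pred (predC good) mcell).
have -> : bad = [set z | predC good (cell z)] `*` setT.
  by apply/seteqP; split => z //= [].
rewrite [X in (_ * X)%E]E fineK// fin_num_measure//.
exact: (fin_measurable_pred (predC good) mcellUV).
Qed.

End Lift.

(** * Score patterns *)

(** A fibre is the complement of the finite union, over [q], of the sets where the value at [q]
    disagrees. *)
Lemma fin_measurable_ffun d (T : measurableType d) (Q : finType)
    (b : T -> Q -> bool) : (forall q, measurable [set x | b x q]) ->
  fin_measurable (fun x => [ffun q => b x q]).
Proof.
move=> mb t.
rewrite (_ : [set _ | _] = ~` \bigcup_(q in setT) [set x | b x q != t q]).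
  apply: measurableC; apply: fin_bigcup_measurable => // q _.
  have -> : [set x | b x q != t q] = if t q then ~` [set x | b x q] else [set x | b x q].
    by case: (t q); apply/seteqP; split => x /=; case: (b x q).
  by case: ifP => _ //; exact: measurableC.
apply/seteqP; split => [x <- [q _]/=|x h]; first by rewrite ffunE eqxx.
apply/ffunP => q; rewrite ffunE; apply/eqP/negPn/negP => bq.
by apply: h; exists q.
Qed.

(** The source carries the sigma-algebra generated by open sets, so preimages of open intervals
    suffice. *)
Lemma continuous_rVB_measurable (R : realType) n (h : 'rV[R]_n -> R) :
  continuous h -> measurable_fun setT (h : 'rVB[R]_n -> R).
Proof.
move=> /continuousP ch; apply: (measurability _ (RGenOpens.measurableE R)).
move=> _ [_ [a [b ->] <-]]; rewrite setTI; apply: sub_sigma_algebra.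
exact/ch/interval_open.
Qed.

Lemma measurable_rVB_coord (R : realType) n (i : 'I_n) :
  measurable_fun setT (fun u : 'rVB[R]_n => (u : 'rV[R]_n) ord0 i).
Proof. apply: continuous_rVB_measurable; exact: coord_continuous. Qed.

Lemma ler_coord_pnorm (R : realType) (p : R) n (v : 'rV[R]_n) (i : 'I_n) :
  0 < p -> `|v ord0 i| <= pnorm p v.
Proof.
move=> p0; rewrite -[leLHS](powRVK p0)//.
apply: ge0_ler_powR; rewrite ?invr_ge0 ?nnegrE ?powR_ge0 ?psum_ge0 ?(ltW p0)//.
by rewrite (bigD1 i)//= lerDl sumr_ge0// => j _; exact: powR_ge0.
Qed.

(** Together with [ler_coord_pnorm], this compares [pnorm] with the largest coordinate, in terms of
    which balls of ['rV[R]_n] are defined. *)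
Lemma pnorm_le_max (R : realType) (p e : R) n (v : 'rV[R]_n) : 0 < p -> 0 <= e ->
  (forall i, `|v ord0 i| <= e) -> pnorm p v <= n%:R `^ p^-1 * e.
Proof.
move=> p0 e0 ve; rewrite -[X in _ * X](powRVK p0)// -powRM ?powR_ge0//.
apply: ge0_ler_powR; rewrite ?invr_ge0 ?nnegrE ?psum_ge0 ?mulr_ge0 ?powR_ge0 ?(ltW p0)//.
rewrite mulr_natl -[X in _ *+ X]card_ord -sumr_const; apply: ler_sum => i _.
by apply: ge0_ler_powR; rewrite ?nnegrE ?(ltW p0).
Qed.

Lemma lipschitz_coord_continuous (R : realType) (p L : R) n m
    (f : 'rV[R]_n -> 'rV[R]_m) (i : 'I_m) : 0 < p -> 0 < L ->
  (forall u v, pnorm p (f u - f v) <= L * pnorm p (u - v)) ->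
  continuous (fun u => f u ord0 i).
Proof.
move=> p0 L0 fL u A /nbhs_ballP[e /= e0 eA].
(* The added one keeps [C] positive even for [n = 0] and makes the final inequality strict. *)
pose C := L * n%:R `^ p^-1 + 1.
have C0 : 0 < C by rewrite ltr_wpDl// mulr_ge0 ?powR_ge0 ?ltW.
apply/nbhs_ballP; exists (e / C); first by rewrite /= divr_gt0.
move=> v [_ uv]; apply: eA; rewrite /ball/=.
have -> : f u ord0 i - f v ord0 i = (f u - f v) ord0 i by rewrite !mxE.
apply: le_lt_trans (ler_coord_pnorm _ _ p0) _.
apply: le_lt_trans (fL u v) _.
have h : pnorm p (u - v) <= n%:R `^ p^-1 * (e / C).
  apply: pnorm_le_max => // [|j]; first by rewrite divr_ge0 ?ltW.
  by have := uv ord0 j; rewrite /ball/= !mxE => /ltW.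
apply: (@le_lt_trans _ _ (L * (n%:R `^ p^-1 * (e / C)))).
  by rewrite ler_wpM2l// ltW.
have -> : L * (n%:R `^ p^-1 * (e / C)) = (C - 1) * (e / C) by rewrite /C addrK mulrA.
by rewrite mulrBl mul1r mulrC divfK ?gt_eqF// gtrBl divr_gt0.
Qed.

(** The domain carries a product sigma-algebra, so measurability is assembled from the
    coordinates. *)
Lemma measurable_pair_dist (R : realType) (p : R) n m :
  measurable_fun setT
    (fun z : ('rVB[R]_n * 'rVB[R]_m) * ('rVB[R]_n * 'rVB[R]_m) =>
       pair_dist p z.1 z.2).
Proof.
rewrite /pair_dist /pnorm.
apply: (@measurableT_comp _ _ _ _ _ _ (@powR R ^~ p^-1)) => //.
apply: measurable_sum => i; apply: (@measurableT_comp _ _ _ _ _ _ (@powR R ^~ p)) => //.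
apply: measurableT_comp => //.
under eq_fun do rewrite mxE; case: (fintype.split i) => j.
  under eq_fun do rewrite !mxE.
  apply: measurable_funB; apply: (measurableT_comp (measurable_rVB_coord _)).
    exact: (measurableT_comp measurable_fst measurable_fst).
  exact: (measurableT_comp measurable_fst measurable_snd).
under eq_fun do rewrite !mxE.
apply: measurable_funB; apply: (measurableT_comp (measurable_rVB_coord _)).
  exact: (measurableT_comp measurable_snd measurable_fst).
exact: (measurableT_comp measurable_snd measurable_snd).
Qed.

(** The label is [i] exactly when coordinate [i] of its encoding is [1]. *)
Lemma fin_measurable_onehot d (T : measurableType d) (R : realType) n
    (k : T -> 'I_n) :
  measurable_fun setT (fun x => (onehot R (k x) : 'rVB[R]_n)) ->
  fin_measurable k.
Proof.
move=> mk i.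
have := (measurableT_comp (measurable_rVB_coord i) mk) measurableT [set 1]
  (measurable_set1 1).
rewrite setTI; congr (measurable _); apply/seteqP; split => x /=; rewrite mxE.
  by case: eqVneq => //= _ /eqP; rewrite eq_sym oner_eq0.
by move=> ->; rewrite eqxx.
Qed.

(* The level sets of [pattern xi \o f] are the cells of the latent space: the
   pattern determines both the maximizers and whether the margin reaches [xi]. *)
Definition pattern (R : realType) (xi : R) n (s : 'rV[R]_n) :
    {ffun 'I_n * 'I_n * bool -> bool} :=
  [ffun q => s ord0 q.1.2 + (if q.2 then xi else 0) <= s ord0 q.1.1].

(** The index is quantified so that the property depends on the pattern alone, not on a predicted
    label. *)
Definition has_margin n (t : {ffun 'I_n * 'I_n * bool -> bool}) :=
  [exists i, [forall j, (j != i) ==> t (i, j, true)]].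

Lemma fin_measurable_pattern (R : realType) (p L xi : R) n m
    (f : 'rV[R]_n -> 'rV[R]_m) : 0 < p -> 0 < L ->
  (forall u v, pnorm p (f u - f v) <= L * pnorm p (u - v)) ->
  fin_measurable (fun u : 'rVB[R]_n => pattern xi (f u)).
Proof.
move=> p0 L0 fL; apply: fin_measurable_ffun => q.
rewrite -[X in measurable X]setTI; apply: measurable_fun_le => //.
  apply: measurable_funD => //; apply: continuous_rVB_measurable.
  exact: lipschitz_coord_continuous fL.
by apply: continuous_rVB_measurable; exact: lipschitz_coord_continuous fL.
Qed.

(** Since [xi] is positive, an index with this margin is the only maximizer, hence equals [k]. *)
Lemma has_marginP (R : realType) (xi : R) n (s : 'rV[R]_n) (k : 'I_n) : 0 < xi ->
  (forall j, s ord0 j <= s ord0 k) ->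
  reflect (forall j, j != k -> s ord0 j + xi <= s ord0 k) (has_margin (pattern xi s)).
Proof.
move=> xi0 sk; apply: (iffP existsP) => [[i /forallP h]|h].
  have ik : i = k.
    apply/eqP/negPn/negP => ik; have := h k; rewrite eq_sym ik ffunE/=.
    by have := sk i; lra.
  by move=> j jk; have := h j; rewrite ik jk ffunE.
by exists k; apply/forallP => j; apply/implyP => jk; rewrite ffunE/= h.
Qed.

Lemma pattern_margin (R : realType) (xi : R) n (s t : 'rV[R]_n) (k : 'I_n) :
  pattern xi s = pattern xi t ->
  (forall j, j != k -> t ord0 j + xi <= t ord0 k) ->
  (forall j, j != k -> s ord0 j + xi <= s ord0 k).
Proof. by move=> /ffunP E h j /h; have := E (k, j, true); rewrite !ffunE/= => ->. Qed.

Lemma pattern_max (R : realType) (xi : R) n (s t : 'rV[R]_n) (k : 'I_n) :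
  pattern xi s = pattern xi t ->
  (forall j, t ord0 j <= t ord0 k) -> (forall j, s ord0 j <= s ord0 k).
Proof.
by move=> /ffunP E h j; have := h j; have := E (k, j, false); rewrite !ffunE/= !addr0 => ->.
Qed.

(** * The bound for the predictions *)

Unset Implicit Arguments.

Theorem theorem5 (R : realType)
  (dO : measure_display) (Omega : measurableType dO) (P : probability Omega R)
  (dE : measure_display) (E : measurableType dE) (X : Omega -> E)
  (nY nA dy da : nat) (p L xi : R)
  (Zy : E -> 'rVB[R]_dy) (Za : E -> 'rVB[R]_da)
  (f : 'rV[R]_dy -> 'rV[R]_nY) (g : 'rV[R]_da -> 'rV[R]_nA)
  (yhat : E -> 'I_nY) (ahat : E -> 'I_nA) (w : R) :
  (2 <= nY)%N -> (2 <= nA)%N -> 1 <= p -> 0 < L -> 0 < xi ->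
  measurable_fun setT X -> measurable_fun setT Zy -> measurable_fun setT Za ->
  (forall u v : 'rV[R]_dy, pnorm p (f u - f v) <= L * pnorm p (u - v)) ->
  (forall u v : 'rV[R]_da, pnorm p (g u - g v) <= L * pnorm p (u - v)) ->
  (forall (x : E) (j : 'I_nY), f (Zy x) ord0 j <= f (Zy x) ord0 (yhat x)) ->
  (forall (x : E) (j : 'I_nA), g (Za x) ord0 j <= g (Za x) ord0 (ahat x)) ->
  measurable_fun setT (fun x => (onehot R (yhat x) : 'rVB[R]_nY)) ->
  measurable_fun setT (fun x => (onehot R (ahat x) : 'rVB[R]_nA)) ->
  IW P p (Zy \o X) (Za \o X) = w%:E -> 0 < w ->
  let delta := 1 - fine (P [set o | (xi%:E <= margin (f (Zy (X o))) (yhat (X o)))%E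
                                  /\ (xi%:E <= margin (g (Za (X o))) (ahat (X o)))%E]) in
  let N := ((nY%:R - 1) `^ p + (nA%:R - 1) `^ p) `^ p^-1 in
  let alpha := 2 `^ p^-1 * N * (1 - delta) in
  let iota := L * (nY + nA)%:R `^ `|2^-1 - p^-1| in
  (IW P p (fun o => (onehot R (yhat (X o)) : 'rVB[R]_nY))
          (fun o => (onehot R (ahat (X o)) : 'rVB[R]_nA))
   <= (2 * w * (iota / xi) * (1 + ln (Num.max 4 (2 * xi * alpha / (iota * w)) - 1))
       + 2 `^ p^-1 * N * delta)%:E)%E.
Proof.
move=> nY2 nA2 p1 L0 xi0 mX mZy mZa fL gL yhat_max ahat_max my ma IWw w0.
set G := [set o | _].
pose delta := 1 - fine (P G).
pose N := ((nY%:R - 1) `^ p + (nA%:R - 1) `^ p) `^ p^-1 : R.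
pose alpha := 2 `^ p^-1 * N * (1 - delta).
pose iota := L * (nY + nA)%:R `^ `|2^-1 - p^-1|.
have p0 : 0 < p by exact: lt_le_trans p1.
pose U := Zy \o X; pose V := Za \o X.
have mU : measurable_fun setT U by exact: measurableT_comp.
have mV : measurable_fun setT V by exact: measurableT_comp.
have fy : fin_measurable (yhat \o X).
  exact: fin_measurable_comp mX (fin_measurable_onehot my).
have fa : fin_measurable (ahat \o X).
  exact: fin_measurable_comp mX (fin_measurable_onehot ma).
have mc1 := fin_measurable_pattern xi p0 L0 fL.
have mc2 := fin_measurable_pattern xi p0 L0 gL.
pose good (t : {ffun 'I_nY * 'I_nY * bool -> bool} * {ffun 'I_nA * 'I_nA * bool -> bool}) :=
  has_margin t.1 && has_margin t.2.
(* [K] is the constant of the margin estimate; [D] bounds the distance between any two pairs of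
   one-hot vectors. *)
pose K := 2 * L / xi; pose D : R := 4 `^ p^-1.
have K0 : 0 < K by rewrite divr_gt0 ?mulr_gt0.
have D0 : 0 <= D by exact: powR_ge0.
have c_ge0 n m (z z' : ('rVB[R]_n * 'rVB[R]_m)%type) : 0 <= pair_dist p z z'.
  exact: powR_ge0.
have goodE o : good (pattern xi (f (U o)), pattern xi (g (V o))) <-> G o.
  rewrite /good /G /=; split.
    move=> /andP[/(has_marginP xi0 (yhat_max (X o))) hy].
    by move=> /(has_marginP xi0 (ahat_max (X o))) ha; split; exact/le_margin.
  move=> [/le_margin hy /le_margin ha]; apply/andP; split.
    exact/(has_marginP xi0 (yhat_max (X o))).
  exact/(has_marginP xi0 (ahat_max (X o))).
have mG : measurable G.
  have := fin_measurable_pred good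
    (fin_measurable_pair (fin_measurable_comp mU mc1) (fin_measurable_comp mV mc2)).
  by congr (measurable _); apply/seteqP; split => o /= /goodE.
have deltaE : fine (P [set o | ~~ good (pattern xi (f (U o)), pattern xi (g (V o)))]) = delta.
  rewrite (_ : [set _ | _] = ~` G); last first.
    by apply/seteqP; split => o /=; [move/negP => h /goodE|move=> h; apply/negP => /goodE].
  by rewrite probability_setC// fineB ?fin_num_measure.
have delta0 : 0 <= delta.
  by rewrite subr_ge0 -lee_fin fineK ?fin_num_measure// probability_le1.
have c_le o o1 o2 (z z' : ('rVB[R]_dy * 'rVB[R]_da)%type) :
    (pattern xi (f z.1), pattern xi (g z.2))
      = (pattern xi (f (U o)), pattern xi (g (V o))) ->
    pattern xi (f z'.1) = pattern xi (f (U o1)) ->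
    pattern xi (g z'.2) = pattern xi (g (V o2)) ->
    pair_dist p (onehot R (yhat (X o)) : 'rVB[R]_nY, onehot R (ahat (X o)) : 'rVB[R]_nA)
      (onehot R (yhat (X o1)) : 'rVB[R]_nY, onehot R (ahat (X o2)) : 'rVB[R]_nA)
    <= K * pair_dist p z z'
       + D * (~~ good (pattern xi (f z.1), pattern xi (g z.2)))%:R.
  (* Margins and maximality pass from the outcomes to [z] and [z'] because patterns determine them;
     on bad cells [D] alone suffices. *)
  move=> [Ey Ea] Ey' Ea'; rewrite Ey Ea.
  case: (boolP (good _)) => [|_]; last first.
    rewrite mulr1; apply: le_trans (@pair_dist_onehot_le R p _ _ _ _ _ _ p0) _.
    by rewrite lerDr mulr_ge0 ?c_ge0 ?(ltW K0).
  rewrite mulr0 addr0 => /andP[/=].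
  move=> /(has_marginP xi0 (yhat_max (X o))) hy /(has_marginP xi0 (ahat_max (X o))) ha.
  apply: (pair_dist_onehot_margin p1 L0 xi0 fL gL).
  - exact: pattern_margin Ey hy.
  - exact: pattern_margin Ea ha.
  - exact: pattern_max Ey' (yhat_max _).
  - exact: pattern_max Ea' (ahat_max _).
have lift (pi : probability (('rVB[R]_dy * 'rVB[R]_da) * ('rVB[R]_dy * 'rVB[R]_da))%type R) :
    coupling (pushforward P (fun o => (U o, V o)))
      (product_measure1 (pushforward P U) (pushforward P V)) pi ->
    (IW P p (fun o => (onehot R (yhat (X o)) : 'rVB[R]_nY))
            (fun o => (onehot R (ahat (X o)) : 'rVB[R]_nA))
     <= K%:E * \int[pi]_z (pair_dist p z.1 z.2)%:E + (D * delta)%:E)%E.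
  move=> cpl; rewrite -deltaE.
  have := W1_lift (S1' := 'rVB[R]_nY) (S2' := 'rVB[R]_nA) (e1 := fun i => onehot R i)
    (e2 := fun i => onehot R i)
    mU mV mc1 mc2 fy fa (@measurable_pair_dist R p _ _) (@measurable_pair_dist R p _ _)
    (@c_ge0 _ _) (@c_ge0 _ _) (ltW K0) D0 c_le cpl.
  exact.
have bound : K * w + D * delta <= 2 * w * (iota / xi) *
    (1 + ln (Num.max 4 (2 * xi * alpha / (iota * w)) - 1)) + 2 `^ p^-1 * N * delta.
  (* With at least two labels and two attribute values, both summands in [N] are at least one. Hence
     [N] is at least the [p]-th root of two, and [D], the square of that root, is at most the factor
     of [delta]. *)
  have n1 (n : nat) : (2 <= n)%N -> 1 <= (n%:R - 1 : R) `^ p.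
    move=> n2; rewrite -[leLHS](powRr0 (n%:R - 1)) ler_powR ?(ltW p0)//.
    by rewrite lerBrDr (_ : 1 + 1 = 2%:R)// ler_nat.
  have N2 : 2 `^ p^-1 <= N.
    apply: ge0_ler_powR; rewrite ?invr_ge0 ?nnegrE ?addr_ge0 ?powR_ge0 ?(ltW p0)//.
    by have := n1 _ nY2; have := n1 _ nA2; lra.
  have DN : D <= 2 `^ p^-1 * N.
    rewrite /D (_ : 4 = 2 * 2 :> R); last by lra.
    by rewrite powRM// ler_wpM2l ?powR_ge0.
  have iotaL : L <= iota.
    rewrite -[leLHS]mulr1 ler_wpM2l ?(ltW L0)// -[leLHS](powRr0 (nY + nA)%:R) ler_powR//.
    by rewrite ler1n addn_gt0 (leq_trans _ nY2).
  (* The maximum with [4] keeps the argument of [ln] at least three, whatever [alpha] is. *)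
  have ln0 : 0 <= ln (Num.max 4 (2 * xi * alpha / (iota * w)) - 1).
    by apply: ln_ge0; rewrite lerBrDr le_max; apply/orP; left; lra.
  apply: lerD; last by rewrite ler_wpM2r.
  apply: (@le_trans _ _ (2 * w * (iota / xi))).
    rewrite (_ : K * w = 2 * w * (L / xi)); last by rewrite /K; ring.
    by rewrite ler_wpM2l ?mulr_ge0 ?(ltW w0)// ler_wpM2r// invr_ge0 ltW.
  rewrite ler_peMr ?lerDl// !mulr_ge0 ?invr_ge0 ?(ltW w0) ?(ltW xi0)//.
  exact: ltW.
apply: (@le_trans _ _ (K * w + D * delta)%:E); last by rewrite lee_fin.
(* An optimal coupling is not assumed: one within [e / K] of [w] is taken, and the factor [K] turns
   the excess into [e]. *)
apply/lee_addgt0Pr => e e0.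
have : (IW P p U V < (w + e / K)%:E)%E by rewrite IWw lte_fin ltrDl divr_gt0.
move=> /ereal_inf_lt[_ [pi [pi_cpl ->]] pi_lt].
apply: le_trans (lift pi pi_cpl) _.
have -> : ((K * w + D * delta)%:E + e%:E = K%:E * (w + e / K)%:E + (D * delta)%:E)%E.
  rewrite -EFinM -!EFinD addrAC; congr (_ + _)%:E.
  by rewrite mulrDr [K * (e / K)]mulrC divfK ?gt_eqF.
by rewrite leeD2r// lee_wpmul2l ?lee_fin ?ltW.
Qed.
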